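(* Let $(L_1,[\cdot,\cdot]_1,\alpha_1,\beta_1)$ and $(L_2,[\cdot,\cdot]_2,\alpha_2,\beta_2)$ be two finite-dimensional (multiplicative) simple BiHom-Lie algebras over $\mathbb{C}$, with induced Lie algebras $(L_1,[\cdot,\cdot]_1')$ and $(L_2,[\cdot,\cdot]_2')$. Then the two BiHom-Lie algebras are isomorphic if and only if there exists a Lie algebra isomorphism $f\colon (L_1,[\cdot,\cdot]_1')\to(L_2,[\cdot,\cdot]_2')$ satisfying $f\circ\alpha_1=\alpha_2\circ f$ and $f\circ\beta_1=\beta_2\circ f$.
   Context: All algebras are finite-dimensional over $\mathbb{C}$. A BiHom-Lie algebra is a $4$-tuple $(L,[\cdot,\cdot],\alpha,\beta)$ where $L$ is a vector space, $\alpha,\beta\colon L\to L$ are linear maps and $[\cdot,\cdot]\colon L\times L\to L$ is a bilinear map such that for all $x,y,z\in L$: (i) $\alpha\circ\beta=\beta\circ\alpha$; (ii) (multiplicativity) $\alpha([x,y])=[\alpha(x),\alpha(y)]$ and $\beta([x,y])=[\beta(x),\beta(y)]$; (iii) $[\beta(x),\alpha(y)]=-[\beta(y),\alpha(x)]$; (iv) $[\beta^{2}(x),[\beta(y),\alpha(z)]]+[\beta^{2}(y),[\beta(z),\alpha(x)]]+[\beta^{2}(z),[\beta(x),\alpha(y)]]=0$. An isomorphism $f\colon (L_1,[\cdot,\cdot]_1,\alpha_1,\beta_1)\to(L_2,[\cdot,\cdot]_2,\alpha_2,\beta_2)$ of BiHom-Lie algebras is a bijective linear map $f\colon L_1\to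 L_2$ with $f\circ\alpha_1=\alpha_2\circ f$, $f\circ\beta_1=\beta_2\circ f$ and $f([x,y]_1)=[f(x),f(y)]_2$ for all $x,y\in L_1$. A subspace $\mathfrak{h}\subseteq L$ is an ideal if $\alpha(\mathfrak{h})\subseteq\mathfrak{h}$, $\beta(\mathfrak{h})\subseteq\mathfrak{h}$ and $[\mathfrak{h},L]\subseteq\mathfrak{h}$. A BiHom-Lie algebra is simple if it has no proper ideals (no ideals other than $0$ and $L$) and is not abelian (its bracket is not identically zero). The structure maps $\alpha,\beta$ of a simple BiHom-Lie algebra are taken to be bijective. The induced Lie algebra of a BiHom-Lie algebra $(L,[\cdot,\cdot],\alpha,\beta)$ with $\alpha,\beta$ bijective is $(L,[\cdot,\cdot]')$ with $[x,y]'=[\alpha^{-1}(x),\beta^{-1}(y)]$ for $x,y\in L$; it is a Lie algebra, and $\alpha,\beta$ are Lie algebra automorphisms of it. *)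

(* Defs.v *)
From HB Require Import structures.
From mathcomp Require Export all_boot all_order all_algebra.
From mathcomp Require Export reals complex.

Set Implicit Arguments.
Unset Strict Implicit.
Unset Printing Implicit Defensive.

Import GRing.Theory Num.Theory.
Local Open Scope ring_scope.

Section LieAlgebras.
Variables (K : numFieldType).

Record lieAlgebra (L : vectType K) := LieAlgebra {
  lie_bracket :> {bilinear L -> L -> L};
  lie_alternating : forall x, lie_bracket x x = 0;
  lie_jacobi : forall x y z,
    lie_bracket x (lie_bracket y z) + lie_bracket y (lie_bracket z x)
      + lie_bracket z (lie_bracket x y) = 0
}.

Record lie_isomorphism (L1 L2 : vectType K) (G1 : lieAlgebra L1)
    (G2 : lieAlgebra L2) (f : 'Hom(L1, L2)) : Prop := LieIsomorphism {
  lie_iso_bij : bijective f;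
  lie_iso_bracket : forall x y, f (G1 x y) = G2 (f x) (f y)
}.

End LieAlgebras.

Section BiHomLieAlgebras.
Variables (K : numFieldType).

Record biHomLie (L : vectType K) := BiHomLie {
  bracket :> {bilinear L -> L -> L};
  alpha : 'End(L);
  beta : 'End(L);
  alpha_betaC : (alpha \o beta = beta \o alpha)%VF;
  alpha_bracket : forall x y,
    alpha (bracket x y) = bracket (alpha x) (alpha y);
  beta_bracket : forall x y,
    beta (bracket x y) = bracket (beta x) (beta y);
  bihom_skew : forall x y,
    bracket (beta x) (alpha y) = - bracket (beta y) (alpha x);
  bihom_jacobi : forall x y z,
    bracket (beta (beta x)) (bracket (beta y) (alpha z))
      + bracket (beta (beta y)) (bracket (beta z) (alpha x))
      + bracket (beta (beta z)) (bracket (beta x) (alpha y)) = 0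
}.

Record bihom_isomorphism (L1 L2 : vectType K) (A1 : biHomLie L1)
    (A2 : biHomLie L2) (f : 'Hom(L1, L2)) : Prop := BiHomIsomorphism {
  bihom_iso_bij : bijective f;
  bihom_iso_alpha : (f \o alpha A1 = alpha A2 \o f)%VF;
  bihom_iso_beta : (f \o beta A1 = beta A2 \o f)%VF;
  bihom_iso_bracket : forall x y, f (A1 x y) = A2 (f x) (f y)
}.

Definition bihom_isomorphic (L1 L2 : vectType K) (A1 : biHomLie L1)
    (A2 : biHomLie L2) : Prop :=
  exists f : 'Hom(L1, L2), bihom_isomorphism A1 A2 f.

Record bihom_ideal (L : vectType K) (A : biHomLie L) (h : {vspace L}) : Prop :=
    BiHomIdeal {
  ideal_alpha : (alpha A @: h <= h)%VS;
  ideal_beta : (beta A @: h <= h)%VS;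
  ideal_bracket : forall x y, x \in h -> A x y \in h
}.

(* Bijectivity of the structure maps is part of the convention for simple
   BiHom-Lie algebras. *)
Record bihom_simple (L : vectType K) (A : biHomLie L) : Prop := BiHomSimple {
  simple_alpha_bij : bijective (alpha A);
  simple_beta_bij : bijective (beta A);
  simple_ideal : forall h : {vspace L},
    bihom_ideal A h -> h = 0%VS \/ h = fullv;
  simple_nonabelian : exists x y, A x y <> 0
}.

End BiHomLieAlgebras.

Section InducedLieAlgebra.
Variables (K : numFieldType) (L : vectType K) (A : biHomLie L).

Local Notation a := (alpha A).
Local Notation b := (beta A).

(* ^-1%VF is a total operation, which is the inverse map when a and b are
   bijective. *)
Definition induced_bracket (x y : L) : L := A (a^-1%VF x) (b^-1%VF y).

Fact induced_bracket_linearl y : linear (induced_bracket^~ y).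
Proof. by move=> k u v; rewrite /induced_bracket linearP linearPl. Qed.

Fact induced_bracket_linearr x : linear (induced_bracket x).
Proof. by move=> k u v; rewrite /induced_bracket linearP linearPr. Qed.

HB.instance Definition _ := bilinear_isBilinear.Build K L L L *:%R *:%R
  induced_bracket (induced_bracket_linearl, induced_bracket_linearr).

Hypotheses (a_bij : bijective a) (b_bij : bijective b).

Let aK : cancel a a^-1%VF.
Proof. by apply/lker0_lfunK/lker0P/bij_inj. Qed.
Let aVK : cancel a^-1%VF a.
Proof. by apply/lker0_lfunVK/lker0P/bij_inj. Qed.
Let bK : cancel b b^-1%VF.
Proof. by apply/lker0_lfunK/lker0P/bij_inj. Qed.
Let bVK : cancel b^-1%VF b.
Proof. by apply/lker0_lfunVK/lker0P/bij_inj. Qed.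

Let abC x : a (b x) = b (a x).
Proof. by rewrite -!comp_lfunE alpha_betaC. Qed.

Fact induced_alternating x : induced_bracket x x = 0.
Proof.
pose u := b^-1%VF (a^-1%VF x).
have -> : x = a (b u) by rewrite bVK aVK.
rewrite /induced_bracket aK abC bK.
have /eqP := bihom_skew A u u.
by rewrite -addr_eq0 -mulr2n -scaler_nat scaler_eq0 pnatr_eq0 => /eqP.
Qed.

Let induced_jacobiE u v w :
  induced_bracket (a (b (b u))) (induced_bracket (a (b (b v))) (a (b (b w))))
    = A (b (b u)) (A (b v) (a w)).
Proof.
by rewrite /induced_bracket !aK; congr (A _ _); apply: (canLR bK);
  rewrite beta_bracket !abC bK.
Qed.

Fact induced_jacobi x y z :
  induced_bracket x (induced_bracket y z)
    + induced_bracket y (induced_bracket z x)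
    + induced_bracket z (induced_bracket x y) = 0.
Proof.
have E t : t = a (b (b (b^-1%VF (b^-1%VF (a^-1%VF t))))) by rewrite !bVK aVK.
by rewrite (E x) (E y) (E z) !induced_jacobiE bihom_jacobi.
Qed.

Definition induced_lie : lieAlgebra L :=
  @LieAlgebra K L induced_bracket induced_alternating induced_jacobi.

End InducedLieAlgebra.

(* Main.v *)
Require Import Defs.

(** When the structure maps are bijective, the two brackets determine each
    other: [x, y]' = [alpha^-1 x, beta^-1 y], and conversely
    [x, y] = [alpha x, beta y]'.  A linear map commuting with alpha and beta
    also commutes with their inverses, so each formula transports the
    preservation of one bracket to the preservation of the other
    ([preserves_induced_bracket]).  Both notions of isomorphism therefore hold
    for the same maps f. *)

Local Open Scope ring_scope.

Section InducedBracket.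
Set Implicit Arguments.
Unset Strict Implicit.
Variable K : numFieldType.

Lemma bij_lfunK (U : vectType K) (g : 'End(U)) :
  bijective g -> cancel g g^-1%VF.
Proof. by move=> /bij_inj/lker0P/lker0_lfunK. Qed.

Lemma bij_lfunVK (U : vectType K) (g : 'End(U)) :
  bijective g -> cancel g^-1%VF g.
Proof. by move=> /bij_inj/lker0P/lker0_lfunVK. Qed.

Lemma intertwine_inv (U V : vectType K)
    (f : 'Hom(U, V)) (g : 'End(U)) (h : 'End(V)) :
  bijective g -> bijective h -> (f \o g = h \o f)%VF ->
  forall x, f (g^-1%VF x) = h^-1%VF (f x).
Proof.
move=> g_bij h_bij fg x; apply: (canRL (bij_lfunK h_bij)).
by rewrite -comp_lfunE -fg comp_lfunE bij_lfunVK.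
Qed.

Lemma bracket_induced (L : vectType K) (A : biHomLie L) :
  bijective (alpha A) -> bijective (beta A) ->
  forall x y, A x y = induced_bracket A (alpha A x) (beta A y).
Proof. by move=> a_bij b_bij x y; rewrite /induced_bracket !bij_lfunK. Qed.

(** Forwards, f is moved across the inverse structure maps in the definition
    of the induced bracket; backwards, across the structure maps themselves in
    [bracket_induced]. *)
Lemma preserves_induced_bracket (L1 L2 : vectType K)
    (A1 : biHomLie L1) (A2 : biHomLie L2) (f : 'Hom(L1, L2)) :
  bijective (alpha A1) -> bijective (beta A1) ->
  bijective (alpha A2) -> bijective (beta A2) ->
  (f \o alpha A1 = alpha A2 \o f)%VF -> (f \o beta A1 = beta A2 \o f)%VF ->
  (forall x y, f (A1 x y) = A2 (f x) (f y)) <->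
  (forall x y,
     f (induced_bracket A1 x y) = induced_bracket A2 (f x) (f y)).
Proof.
move=> a1_bij b1_bij a2_bij b2_bij fa fb; split=> f_bracket x y.
  rewrite /induced_bracket f_bracket.
  by rewrite (intertwine_inv a1_bij a2_bij fa) (intertwine_inv b1_bij b2_bij fb).
by rewrite !bracket_induced // f_bracket -!comp_lfunE fa fb.
Qed.

End InducedBracket.

Theorem proposition2p4 (R : realType) (L1 L2 : vectType R[i])
    (A1 : biHomLie L1) (A2 : biHomLie L2)
    (S1 : bihom_simple A1) (S2 : bihom_simple A2) :
  bihom_isomorphic A1 A2 <->
  exists f : 'Hom(L1, L2),
    [/\ lie_isomorphism
          (induced_lie (simple_alpha_bij S1) (simple_beta_bij S1))
          (induced_lie (simple_alpha_bij S2) (simple_beta_bij S2)) f,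
        (f \o alpha A1 = alpha A2 \o f)%VF &
        (f \o beta A1 = beta A2 \o f)%VF].
Proof.
have bracketP := preserves_induced_bracket
  (simple_alpha_bij S1) (simple_beta_bij S1)
  (simple_alpha_bij S2) (simple_beta_bij S2).
split=> -[f].
  case=> f_bij fa fb f_bracket; exists f; split=> //; split=> //.
  exact: (bracketP f fa fb).1.
case=> -[f_bij f_bracket] fa fb; exists f; split=> //.
exact: (bracketP f fa fb).2.
Qed.
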